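(* For every $x\in X$, $$\sum_{z\in\Gamma(x)}\widehat{z}=\theta_1\widehat{x},\qquad\text{where }\theta_1=q^2[k-1][n-k-1]-1.$$
   Context: Let $\mathbb{F}_q$ be a finite field with $q$ elements, let $n,k$ be integers with $n>2k\geq 6$, and let $V$ be an $n$-dimensional vector space over $\mathbb{F}_q$. For $m\in\mathbb{Z}$ write $[m]=(q^m-1)/(q-1)$. Let $P$ be the set of all subspaces of $V$ and $P_\ell$ the set of $\ell$-dimensional subspaces; put $X=P_k$. The Grassmann graph $\Gamma=J_q(n,k)$ has vertex set $X$, with $x,y\in X$ adjacent iff $\dim(x\cap y)=k-1$; $\Gamma(x)$ is the set of neighbours of $x$. Let $E$ be a (real) Euclidean space of dimension $[n]-1$ with inner product $\langle\,,\,\rangle$, and let $P_1\to E$, $s\mapsto\widehat{s}$ be a map such that: $E=\mathrm{Span}\{\widehat{s}\mid s\in P_1\}$; $\|\widehat{s}\|^2=[n]-1$ for $s\in P_1$; $\langle\widehat{s},\widehat{t}\rangle=-1$ for distinct $s,t\in P_1$; and $\sum_{s\in P_1}\widehat{s}=0$. For $u\in P$ define $\widehat{u}=\sum_{s\in P_1,\,s\subseteq u}\widehat{s}$. *)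

(* Defs.v *)
From HB Require Import structures.
From mathcomp Require Import all_boot all_order all_algebra all_field.
From mathcomp Require Import sesquilinear reals.

Set Implicit Arguments.
Unset Strict Implicit.
Unset Printing Implicit Defensive.

(* VectorInternalTheory exposes {vspace V} as a subtype of the matrices over F,
   which makes it finite when F is. *)
Import GRing.Theory VectorInternalTheory.
Local Open Scope ring_scope.

HB.instance Definition _ (F : finFieldType) (V : vectType F) :=
  [Countable of {vspace V} by <:].
HB.instance Definition _ (F : finFieldType) (V : vectType F) :=
  [Finite of {vspace V} by <:].

(* [m] = (q^m - 1) / (q - 1), with m ranging over all integers; for m < 0 the
   value is in general not an integer, hence the codomain R. *)
Definition qnum (R : realType) (q : nat) (m : int) : R :=
  (q%:R ^ m - 1) / (q%:R - 1).

(* The set P_l of l-dimensional subspaces of V, as a finite type. *)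
Record subspaces (F : finFieldType) (V : vectType F) (l : nat) : Type :=
  Subspaces { subspace_val :> {vspace V}; _ : \dim subspace_val == l }.

HB.instance Definition _ (F : finFieldType) (V : vectType F) (l : nat) :=
  [isSub for @subspace_val F V l].
HB.instance Definition _ (F : finFieldType) (V : vectType F) (l : nat) :=
  [Finite of subspaces V l by <:].

(* Only meaningful for 0 < k: for k = 0 the truncation 0.-1 = 0 would make the
   unique vertex adjacent to itself. *)
Definition grassmann_adj (F : finFieldType) (V : vectType F) (k : nat) :
    rel (subspaces V k) :=
  [rel x y : subspaces V k | \dim (x :&: y) == k.-1].

Definition grassmann_nbrs (F : finFieldType) (V : vectType F) (k : nat)
    (x : subspaces V k) : {set subspaces V k} :=
  [set z | grassmann_adj x z].

(* Extension to all subspaces of a map h defined on P_1. *)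
Definition hat (F : finFieldType) (V : vectType F) (R : realType)
    (E : vectType R) (h : subspaces V 1 -> E) (u : {vspace V}) : E :=
  \sum_(s : subspaces V 1 | (s <= u)%VS) h s.

(* Main.v *)
Require Import Defs.
From HB Require Import structures.
From mathcomp Require Import all_boot all_order all_algebra all_field.
From mathcomp Require Import sesquilinear reals.
From mathcomp Require Import ring.

Set Implicit Arguments.
Unset Strict Implicit.
Unset Printing Implicit Defensive.

Import GRing.Theory.
Local Open Scope ring_scope.

(** Expand every vector hat z into its points and exchange the two sums: the
    vector h s of a point s then appears once for each neighbour z of x lying
    over s, and this number depends only on whether s lies in x. If it is A for
    s inside x and B for s outside x, the sum of the hats of the neighbours is
    A (hat x) + B (sum of h over the points outside x), and since h sums to
    zero over all points this is (A - B) (hat x).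

    A neighbour z is an extension, of the dimension of x, of the hyperplane
    x :&: z of x ([neighbours_by_meet]), so A and B are found by fixing this
    hyperplane w. If s lies in x, then z lies over s exactly when w does: there
    are [k - 1] hyperplanes of x over s ([card_hyperplanes]) and each has
    q [n - k] extensions meeting x in it ([card_extensions]), whence
    A = q [k - 1] [n - k]. If s is outside x, each of the [k] hyperplanes w
    leaves exactly the one choice z = w + s, whence B = [k]. Finally
    [k] = 1 + q [k - 1] and [n - k] - 1 = q [n - k - 1] turn A - B into
    q^2 [k - 1] [n - k - 1] - 1.

    The subspace counts come from double counting incidences with points, the
    number of points of a subspace of dimension d being [d]. *)

Lemma double_counting (A B : finType) (P : {set A}) (Q : {set B})
    (r : A -> B -> bool) (m p : nat) :
    (forall a, a \in P -> #|[set b in Q | r a b]| = m) ->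
    (forall b, b \in Q -> #|[set a in P | r a b]| = p) ->
  (#|P| * m = #|Q| * p)%N.
Proof.
move=> Pm Qp; rewrite -!sum_nat_const.
transitivity (\sum_(a in P) \sum_(b in Q) r a b)%N.
  by apply: eq_bigr => a /Pm <-; rewrite -sum1dep_card big_mkcondr.
rewrite exchange_big /=; apply: eq_bigr => b /Qp <-.
by rewrite -sum1dep_card big_mkcondr.
Qed.

(** * q-integers *)

(** The q-integer [m] as a natural number, so that it can be a cardinal. *)
Definition gauss (q m : nat) : nat := (\sum_(i < m) q ^ i)%N.

Lemma gaussD q m j : (gauss q (j + m) = gauss q j + q ^ j * gauss q m)%N.
Proof.
rewrite /gauss big_split_ord /= big_distrr /=.
by congr addn; apply: eq_bigr => i _; rewrite expnD.
Qed.

Lemma gaussS q m : gauss q m.+1 = (1 + q * gauss q m)%N.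
Proof. by rewrite -add1n gaussD expn1 /gauss big_ord1. Qed.

Lemma gauss_gt0 q m : (0 < gauss q m.+1)%N.
Proof. by rewrite gaussS. Qed.

Lemma qnum_gauss (R : realType) (q m : nat) :
  (1 < q)%N -> qnum R q m = (gauss q m)%:R.
Proof.
move=> q_gt1; rewrite /qnum -exprnP subrX1 mulrC mulKf; last first.
  by rewrite subr_eq0 Num.Theory.pnatr_eq1 gtn_eqF.
by rewrite /gauss natr_sum; apply: eq_bigr => i _; rewrite natrX.
Qed.

(** * Counting subspaces over a finite field *)

Section Counting.

Variables (F : finFieldType) (V : vectType F).
Local Notation q := #|F|.
Implicit Types s u w x z : {vspace V}.

Lemma card_field_gt1 : (1 < q)%N.
Proof. exact: finNzRing_gt1. Qed.

(** The finite type structure on vectors is carried by the alias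
    [finvect_type V] of V. *)
Lemma card_vectors u :
  #|[set v : finvect_type V | (v : V) \in u]| = (q ^ \dim u)%N.
Proof.
(* Once V is a literal record, the vector space structures of V and of the
   alias are convertible. *)
case: V u => T c u.
pose W : vectType F := Vector.Pack c.
rewrite cardsE; exact: (@card_vspace F (finvect_type W : finType) c u).
Qed.

Definition points u : {set {vspace V}} := [set s | (s <= u)%VS & \dim s == 1%N].

(** Every point carries q - 1 nonzero vectors, and every nonzero vector spans
    exactly one point. *)
Lemma card_points u : #|points u| = gauss q (\dim u).
Proof.
have q1_gt0 : (0 < q - 1)%N by rewrite subn_gt0 card_field_gt1.
apply/eqP; rewrite -(eqn_pmul2r q1_gt0); apply/eqP.
pose nz w := [set v : finvect_type V | (v : V) \in w] :\ 0.
have card_nz w : #|nz w| = (q ^ \dim w - 1)%N.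
  rewrite -card_vectors [in RHS](cardsD1 (0 : finvect_type V)) inE.
  by rewrite mem0v add1n subn1.
transitivity (#|nz u| * 1)%N.
  apply: (double_counting (r := fun s (v : finvect_type V) => (v : V) \in s)).
    move=> s; rewrite inE => /andP[su /eqP ds].
    transitivity #|nz s|; last by rewrite card_nz ds expn1.
    apply: eq_card => v.
    rewrite !inE -andbA; congr (_ && _).
    by apply: andb_idl => /(subvP su).
  move=> v; rewrite !inE => /andP[v0 vu].
  apply/eqP/cards1P; exists <[v : V]>%VS.
  apply/setP => s; rewrite !inE.
  apply/idP/eqP => [/andP[/andP[_ /eqP ds] vs]|->].
    apply/esym/eqP; rewrite eqEdim -memvE vs ds dim_vline.
    by move: v0; case: (_ != _).
  by rewrite -!memvE vu memv_line dim_vline (v0 : (v : V) != 0).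
by rewrite muln1 card_nz subn1 predn_exp mulnC subn1.
Qed.

Lemma card_pointsD u w : (w <= u)%VS ->
  #|points u :\: points w| = (q ^ \dim w * gauss q (\dim u - \dim w))%N.
Proof.
move=> wu; rewrite cardsD (setIidPr _).
  by rewrite !card_points -{1}(subnKC (dimvS wu)) gaussD addKn.
by apply/subsetP => s; rewrite !inE => /andP[/subv_trans->].
Qed.

Lemma cap_point w s : \dim s = 1%N -> ~~ (s <= w)%VS -> (w :&: s = 0)%VS.
Proof.
move=> ds sw; apply/eqP; rewrite -dimv_eq0 -leqn0 -ltnS -ds.
rewrite ltn_neqAle dimvS ?capvSr // andbT; apply: contra sw => /eqP d.
have /eqP <- : (w :&: s)%VS == s by rewrite eqEdim capvSr d leqnn.
exact: capvSl.
Qed.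

Lemma dim_add_point w s : \dim s = 1%N -> ~~ (s <= w)%VS ->
  \dim (w + s) = (\dim w).+1.
Proof.
by move=> ds sw; rewrite dimv_disjoint_sum ?cap_point // ds addn1.
Qed.

Lemma add_point_eq w s z : \dim s = 1%N -> ~~ (s <= w)%VS ->
  (w <= z)%VS -> (s <= z)%VS -> \dim z = (\dim w).+1 -> (w + s = z)%VS.
Proof.
move=> ds sw wz sz dz; apply/eqP.
by rewrite eqEdim subv_add wz sz dim_add_point // dz leqnn.
Qed.

Definition hyperplanes u x : {set {vspace V}} :=
  [set w | [&& (u <= w)%VS, (w <= x)%VS & \dim x == (\dim w).+1]].

(** Induction on the codimension c of u in x. The pairs (w, s) with w a
    hyperplane over u and s a point of w outside u are counted in two ways: for
    a fixed s, such w are the hyperplanes over u + s, which has codimension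
    c - 1. The resulting relation has the factor [c - 1] on both sides, so it
    determines the count only for c > 1; for c = 1 the only hyperplane is u. *)
Lemma card_hyperplanes u x : (u <= x)%VS ->
  #|hyperplanes u x| = gauss q (\dim x - \dim u).
Proof.
move=> ux; move def_c: (\dim x - \dim u)%N => c.
elim: c => [|c IHc] in u ux def_c *.
  rewrite /gauss big_ord0; apply: eq_card0 => w; rewrite !inE.
  apply/and3P => -[uw _ /eqP dx].
  by move: (dimvS uw) def_c; rewrite dx => /subSn->.
have dx : \dim x = (\dim u + c.+1)%N by rewrite -def_c subnKC // dimvS.
case: c => [|c] in IHc def_c dx *.
  rewrite /gauss big_ord1; apply/eqP/cards1P; exists u.
  apply/setP => w; rewrite !inE; apply/and3P/eqP => [[uw _ dw]|->].
    by apply/esym/eqP; rewrite eqEdim uw -ltnS -(eqP dw) dx addn1 leqnn.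
  by rewrite subvv ux dx addn1.
have g_gt0 : (0 < q ^ \dim u * gauss q c.+1)%N.
  by rewrite muln_gt0 gauss_gt0 expn_gt0 (ltnW card_field_gt1).
apply/eqP; rewrite -(eqn_pmul2r g_gt0); apply/eqP.
transitivity (#|points x :\: points u| * gauss q c.+1)%N; last first.
  by rewrite card_pointsD // def_c mulnCA mulnA.
apply: (double_counting (r := fun w s => (s <= w)%VS)) => [w|s].
  rewrite inE => /and3P[uw wx /eqP dw].
  have -> : c.+1 = (\dim w - \dim u)%N.
    by move: dw; rewrite dx !addnS => -[<-]; rewrite -addnS addKn.
  rewrite -card_pointsD //; apply: eq_card => s; rewrite !inE.
  case: (boolP (s <= w)%VS) => [sw|]; last by rewrite !andbF.
  by rewrite (subv_trans sw wx) andbT.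
rewrite !inE => /andP[+ /andP[sx /eqP ds]]; rewrite ds eqxx andbT => su.
rewrite -(IHc (u + s)%VS) ?subv_add ?ux //.
  apply: eq_card => w; rewrite !inE subv_add.
  by case: (u <= w)%VS; case: (s <= w)%VS; rewrite ?andbF ?andbT.
by rewrite dim_add_point // subnS def_c.
Qed.

(** Each point outside x lies in exactly one such extension z of w, namely
    w + s, while each z has q ^ \dim w points outside w, all of them outside
    x. *)
Lemma card_extensions w x : (w <= x)%VS -> \dim x = (\dim w).+1 ->
  #|[set z | (\dim z == \dim x) && ((x :&: z)%VS == w)]|
    = (q * gauss q (\dim {:V} - \dim x))%N.
Proof.
move=> wx dx.
have g_gt0 : (0 < q ^ \dim w)%N by rewrite expn_gt0 (ltnW card_field_gt1).
apply/eqP; rewrite -(eqn_pmul2r g_gt0); apply/eqP.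
transitivity (#|points fullv :\: points x| * 1)%N; last first.
  by rewrite muln1 card_pointsD ?subvf // dx expnS mulnAC.
apply: (double_counting (r := fun z s => (s <= z)%VS)) => [z|s].
  rewrite inE => /andP[/eqP dz /eqP xz].
  have wz : (w <= z)%VS by rewrite -xz capvSr.
  have <- : #|points z :\: points w| = (q ^ \dim w)%N.
    by rewrite card_pointsD // dz dx subSnn /gauss big_ord1 muln1.
  apply: eq_card => s; rewrite !inE subvf -xz subv_cap /=.
  by case: (s <= z)%VS; rewrite ?andbF ?andbT.
rewrite !inE => /andP[+ /andP[_ /eqP ds]]; rewrite ds eqxx andbT => sx.
have sw : ~~ (s <= w)%VS by apply: contra sx => /subv_trans->.
apply/eqP/cards1P; exists (w + s)%VS; apply/setP => z; rewrite !inE.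
apply/andP/eqP => [[/andP[/eqP dz /eqP xz] sz]|->].
  by apply/esym; rewrite (add_point_eq (z := z)) // ?dz // -xz capvSr.
(* By the modular law, w + s meets x in w + (s :&: x) = w. *)
rewrite addvSr dim_add_point // dx eqxx capvC -vspace_modl //.
by rewrite capvC (cap_point ds sx) addv0 eqxx.
Qed.

(** The neighbourhood of x in the Grassmann graph, as a set of subspaces rather
    than of vertices; the successor on the right keeps it faithful, namely
    empty, for x = 0. *)
Definition neighbours x : {set {vspace V}} :=
  [set z | (\dim z == \dim x) && (\dim x == (\dim (x :&: z)).+1)].

(** Distinct hyperplanes w of x have disjoint sets of extensions z, since w is
    recovered as x :&: z. *)
Lemma neighbours_by_meet x (P : pred {vspace V}) :
  #|[set z in neighbours x | P z]| =
  (\sum_(w in hyperplanes 0 x)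
     #|[set z | [&& \dim z == \dim x, (x :&: z)%VS == w & P z]]|)%N.
Proof.
rewrite -sum1dep_card.
rewrite (partition_big (fun z => x :&: z)%VS (fun w => w \in hyperplanes 0 x)).
  apply: eq_bigr => w; rewrite inE => /and3P[_ _ dw].
  rewrite -sum1dep_card; apply: eq_bigl => z; rewrite !inE.
  case: (altP ((x :&: z)%VS =P w)) => [->|]; last by rewrite !andbF.
  by rewrite dw !andbT.
by move=> z; rewrite !inE sub0v capvSl => /andP[/andP[]].
Qed.

Lemma card_neighbours_inside x s : \dim s = 1%N -> (s <= x)%VS ->
  #|[set z in neighbours x | (s <= z)%VS]|
    = (gauss q (\dim x - 1) * (q * gauss q (\dim {:V} - \dim x)))%N.
Proof.
move=> ds sx; rewrite neighbours_by_meet -ds -card_hyperplanes //.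
rewrite -sum_nat_const.
(* A hyperplane that misses s contributes nothing: z over s, with s in x,
   forces s into x :&: z. *)
rewrite (big_setID (hyperplanes s x)) /= [X in (_ + X)%N]big1 ?addn0 => [|w].
  rewrite (setIidPr _); last first.
    by apply/subsetP => w; rewrite !inE sub0v => /and3P[_ -> ->].
  apply: eq_bigr => w; rewrite inE => /and3P[sw wx /eqP dw].
  rewrite -(card_extensions wx) //; apply: eq_card => z; rewrite !inE.
  apply/and3P/andP => [[-> ->]|[-> /eqP xz]] //; split=> //; first exact/eqP.
  by apply: (subv_trans sw); rewrite -xz capvSr.
rewrite !inE sub0v /= => /andP[+ wxd]; rewrite wxd andbT => sw.
apply: eq_card0 => z; rewrite !inE; apply: contraNF sw => /and3P[_ /eqP <- sz].
by rewrite subv_cap sx.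
Qed.

Lemma card_neighbours_outside x s : \dim s = 1%N -> ~~ (s <= x)%VS ->
  #|[set z in neighbours x | (s <= z)%VS]| = gauss q (\dim x).
Proof.
move=> ds sx; rewrite neighbours_by_meet.
have <- : #|hyperplanes 0 x| = gauss q (\dim x).
  by rewrite card_hyperplanes ?sub0v // dimv0 subn0.
rewrite -sum1_card.
apply: eq_bigr => w; rewrite inE => /and3P[_ wx /eqP dx].
have sw : ~~ (s <= w)%VS by apply: contra sx => /subv_trans->.
apply/eqP/cards1P; exists (w + s)%VS; apply/setP => z; rewrite !inE.
apply/and3P/eqP => [[/eqP dz /eqP xz sz]|->].
  by apply/esym; rewrite (add_point_eq (z := z)) // ?dz // -xz capvSr.
rewrite addvSr dim_add_point // dx eqxx capvC -vspace_modl //.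
by rewrite capvC (cap_point ds sx) addv0 eqxx.
Qed.

End Counting.

(** * The eigenvector identity *)

Lemma card_grassmann_nbrs (F : finFieldType) (V : vectType F) (k : nat)
    (x : subspaces V k) (P : pred {vspace V}) : (0 < k)%N ->
  #|[set z in grassmann_nbrs x | P (val z)]|
    = #|[set z in neighbours (val x) | P z]|.
Proof.
move=> k_gt0; rewrite -(card_imset _ val_inj); apply: eq_card => z.
have dx := eqP (valP x); rewrite !inE.
apply/imsetP/idP => [[{}z + ->]|].
  rewrite !inE /= (eqP (valP z)) dx eqxx /= => /andP[/eqP dxz ->].
  by rewrite dxz prednK // eqxx.
rewrite dx => /andP[/andP[dz dxz] Pz].
exists (Subspaces dz); rewrite // !inE Pz andbT /grassmann_adj /=.
by rewrite -eqSS prednK // eq_sym.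
Qed.

Theorem lemma6p6 (F : finFieldType) (q : nat) (q_card : #|F| = q)
    (n k : nat) (n_gt2k : (2 * k < n)%N) (k_ge : (6 <= 2 * k)%N)
    (V : vectType F) (dimV : \dim {:V} = n)
    (R : realType) (E : vectType R)
    (dimE : (\dim {:E})%:R = qnum R q n - 1)
    (ip : {dot E for idfun})
    (h : subspaces V 1 -> E)
    (h_span : <<[seq h s | s : subspaces V 1]>>%VS = {:E}%VS)
    (h_norm : forall s : subspaces V 1, ip (h s) (h s) = qnum R q n - 1)
    (h_ip : forall s t : subspaces V 1, s != t -> ip (h s) (h t) = -1)
    (h_sum : \sum_(s : subspaces V 1) h s = 0)
    (x : subspaces V k) :
  let theta1 : R :=
    q%:R ^+ 2 * qnum R q (k%:Z - 1) * qnum R q (n%:Z - k%:Z - 1) - 1 in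
  \sum_(z in grassmann_nbrs x) hat h (val z) = theta1 *: hat h (val x).
Proof.
move=> theta1.
have k_gt0 : (0 < k)%N by case: k k_ge {n_gt2k x theta1}.
have n_gtk : (k < n)%N.
  by apply: leq_ltn_trans n_gt2k; rewrite leq_pmull.
have q_gt1 : (1 < q)%N by rewrite -q_card card_field_gt1.
have dx : \dim (val x) = k := eqP (valP x).
pose A := (gauss q k.-1 * (q * gauss q (n - k)))%N.
pose B := gauss q k.
have countE (s : subspaces V 1) :
    #|[set z in grassmann_nbrs x | (val s <= val z)%VS]|
      = if (val s <= val x)%VS then A else B.
  have ds := eqP (valP s).
  rewrite (card_grassmann_nbrs x (fun z => (val s <= z)%VS)) //.
  case: ifPn => sx.
    by rewrite card_neighbours_inside // dx dimV q_card subn1.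
  by rewrite card_neighbours_outside // dx q_card.
have -> : \sum_(z in grassmann_nbrs x) hat h (val z) =
    \sum_(s : subspaces V 1) h s *+ (if (val s <= val x)%VS then A else B).
  rewrite /hat (exchange_big_dep xpredT) //=; apply: eq_bigr => s _.
  by rewrite -countE -sumr_const; apply: eq_bigl => z; rewrite inE.
have outside : \sum_(s : subspaces V 1 | ~~ (val s <= val x)%VS) h s
    = - hat h (val x).
  apply/eqP; rewrite -addr_eq0 addrC; move: h_sum => /eqP.
  by rewrite (bigID (fun s => (val s <= val x)%VS)).
rewrite (bigID (fun s => (val s <= val x)%VS)) /=.
rewrite (eq_bigr (fun s => A%:R *: h s)); last first.
  by move=> s ->; rewrite scaler_nat.
rewrite [X in _ + X](eq_bigr (fun s => B%:R *: h s)); last first.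
  by move=> s /negbTE ->; rewrite scaler_nat.
rewrite -!scaler_sumr outside scalerN -scalerBl; congr (_ *: _).
rewrite /theta1 subzn ?(ltnW n_gtk) // -!predn_int ?subn_gt0 //.
rewrite !qnum_gauss // /A /B.
have -> : (n - k = (n - k).-1.+1)%N by rewrite prednK // subn_gt0.
have -> : (k = k.-1.+1)%N by rewrite prednK.
rewrite !gaussS /= !(natrM, natrD).
ring.
Qed.
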